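(* Let $m \ge 1$, let $A, B$ be families with $dom(A) = dom(B)$ of size at most $m$, and let $w$ be a positive integer. Then the following are equivalent: (1) Spoiler has a winning strategy in the game $\mathrm{CS}^m_w(A,B)$; (2) there is a $\mathcal{C}_m$-formula $\phi$ with $|\phi| \le w$ such that $(A,B) \models \phi$.
   Context: Fix a relational vocabulary (possibly with constants). Counting logic $\mathcal{C}$ is first-order logic extended by quantifiers $\exists^{\ge k} x\,\varphi$ (at least $k$ distinct values of $x$ satisfy $\varphi$) and $\forall^{\ge k}x\,\varphi := \neg\exists^{\ge k}x\,\neg\varphi$, $k\ge 1$. $\mathcal{C}_m$ is the fragment using only variables $x_1,\dots,x_m$. Size: $|\text{atomic}|=1$, $|\neg\varphi|=|\varphi|+1$, $|\varphi\vee\psi|=|\varphi\wedge\psi|=|\varphi|+|\psi|$, $|Q^{\ge k}x\,\varphi|=|\varphi|+1$ for $Q\in\{\exists,\forall\}$. An interpretation is a pair $(\mathcal{A},\alpha)$ with $\mathcal{A}$ a structure with universe $U^{\mathcal{A}}$ and $\alpha$ a finite partial map from indices $j\in\mathbb{N}$ (of variables $x_j$) to $U^{\mathcal{A}}$. A family is a set of interpretations $(\mathcal{A},\alpha_i)$ with the same structure $\mathcal{A}$ and the same domain $D=dom(\alpha_i)$; $dom(A)$ denotes this $D$. $(A,B)\models\phi$ means every interpretation in $A$ satisfies $\phi$ and every interpretation in $B$ satisfies $\neg\phi$. $\alpha(a/j)$ maps $j$ to $a$ and agrees with $\alpha$ elsewhere. A choice function on $A$ is a map $F: A\to U^{\mathcal{A}}$;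 $A(F/j) := \{(\mathcal{A},\alpha(F(\mathcal{A},\alpha)/j)) : (\mathcal{A},\alpha)\in A\}$. A $k$-choice function on $A$ is a tuple $F^k=(F^k_1,\dots,F^k_k)$ of choice functions such that for each $(\mathcal{A},\alpha)\in A$ the values $F^k_i(\mathcal{A},\alpha)$ are pairwise distinct; $A(F^k/j):=\{(\mathcal{A},\alpha(F^k_i(\mathcal{A},\alpha)/j)) : (\mathcal{A},\alpha)\in A, 1\le i\le k\}$. A choice function $F$ is selected from $F^k$ if $F(I)\in\{F^k_1(I),\dots,F^k_k(I)\}$ for every $I\in A$. The game $\mathrm{CS}^m_w(A,B)$ between Spoiler and Duplicator has positions $(w,A,B)$. From position $(w,A,B)$ Spoiler chooses one of: ($\neg$) continue from $(w-1,B,A)$; ($\vee$) choose $u,v\ge1$, $u+v=w$, and partition $A$ into $C,D$; Duplicator chooses to continue from $(u,C,B)$ or $(v,D,B)$; ($\wedge$) same with $B$ split into $C,D$, continuing from $(u,A,C)$ or $(v,A,D)$; ($\exists^{\ge k}$) choose $j\in[m]$, $k\in\mathbb{N}$, a $k$-choice function $F^k$ on $A$, and for every $k$-choice function $G^k$ on $B$ a choice function $G$ selected from $G^k$; let $B( *^k/j)$ be the union of $B(G/j)$ over all $G^k$; continue from $(w-1, A(F^k/j), B( *^k/j))$; ($\forall^{\ge k}$) symmetric, with $F^k$ a $k$-choice function on $B$ and selections on $A$, continuing from $(w-1, A( *^k/j), B(F^k/j))$. The game ends at a position $(w,A,B)$ if there is an atomic formula $\phi$ with $(A,B)\models\phi$,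 in which case Spoiler wins, or if $w=1$ and there is no such atomic formula, in which case Duplicator wins.
   Formalization: The atomic formulas that end the game are restricted to those over x_1,…,x_m; with arbitrary atomic formulas the claim fails when dom(A) contains an index above m (e.g. m=w=1, dom={2}, P(x_2)). For dom(A) within [m] the two games agree. *)

(* Defs.v *)
From mathcomp Require Import all_boot finmap.
From mathcomp Require Import classical_sets.

Set Implicit Arguments.
Unset Strict Implicit.
Unset Printing Implicit Defensive.

Local Open Scope classical_set_scope.

Record vocabulary := Vocabulary {
  rel_symb : Type;
  arity : rel_symb -> nat;
  const_symb : Type }.

Record structure (L : vocabulary) := Struct {
  univ : Type;
  univ_inhabited : inhabited univ;
  rel_interp : forall r : rel_symb L, set ((arity r).-tuple univ);
  const_interp : const_symb L -> univ }.

Inductive term (L : vocabulary) :=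
| Var of nat
| Const of const_symb L.
Arguments Var {L}.

Inductive atomic (L : vocabulary) :=
| Eq of term L & term L
| Rel (r : rel_symb L) of (arity r).-tuple (term L).

Inductive formula (L : vocabulary) :=
| Atom of atomic L
| Neg of formula L
| Or of formula L & formula L
| And of formula L & formula L
| ExGeq (k : nat) of 0 < k & nat & formula L
| AllGeq (k : nat) of 0 < k & nat & formula L.

Section Syntax.
Variable L : vocabulary.

Fixpoint fsize (phi : formula L) : nat :=
  match phi with
  | Atom _ => 1
  | Neg psi => (fsize psi).+1
  | Or psi chi | And psi chi => fsize psi + fsize chi
  | ExGeq _ _ _ psi | AllGeq _ _ _ psi => (fsize psi).+1
  end.

Definition term_vars (t : term L) : seq nat :=
  if t is Var j then [:: j] else [::].

Definition atomic_vars (a : atomic L) : seq nat :=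
  match a with
  | Eq s t => term_vars s ++ term_vars t
  | Rel _ ts => flatten (map term_vars ts)
  end.

Fixpoint free_vars (phi : formula L) : seq nat :=
  match phi with
  | Atom a => atomic_vars a
  | Neg psi => free_vars psi
  | Or psi chi | And psi chi => free_vars psi ++ free_vars chi
  | ExGeq _ _ j psi | AllGeq _ _ j psi =>
      [seq i <- free_vars psi | i != j]
  end.

(* Free and bound variables, including those occurring only in a quantifier. *)
Fixpoint all_vars (phi : formula L) : seq nat :=
  match phi with
  | Atom a => atomic_vars a
  | Neg psi => all_vars psi
  | Or psi chi | And psi chi => all_vars psi ++ all_vars chi
  | ExGeq _ _ j psi | AllGeq _ _ j psi => j :: all_vars psi
  end.

Definition var_index (m j : nat) : bool := 1 <= j <= m.

Definition in_C (m : nat) (phi : formula L) : bool :=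
  all (var_index m) (all_vars phi).

End Syntax.

Definition assignment (L : vocabulary) (S : structure L) := {fmap nat -> univ S}.

Section Semantics.
Variables (L : vocabulary) (S : structure L).
Implicit Type alpha : assignment S.

Definition eval alpha (t : term L) : option (univ S) :=
  match t with
  | Var j => alpha.[? j]%fmap
  | Const c => Some (const_interp S c)
  end.

Definition atomic_holds alpha (a : atomic L) : Prop :=
  match a with
  | Eq s t => exists2 u, eval alpha s = Some u & eval alpha t = Some u
  | Rel r ts => exists2 us : (arity r).-tuple (univ S),
      forall i, eval alpha (tnth ts i) = Some (tnth us i) & rel_interp us
  end.

(* Only meaningful when the free variables of the formula are in the domain of
   the assignment; [satisfies] adds this condition. *)
Fixpoint holds alpha (phi : formula L) : Prop :=
  match phi with
  | Atom a => atomic_holds alpha a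
  | Neg psi => ~ holds alpha psi
  | Or psi chi => holds alpha psi \/ holds alpha chi
  | And psi chi => holds alpha psi /\ holds alpha chi
  | ExGeq k _ j psi => exists2 v : 'I_k -> univ S,
      injective v & forall i, holds alpha.[j <- v i]%fmap psi
  | AllGeq k _ j psi => ~ exists2 v : 'I_k -> univ S,
      injective v & forall i, ~ holds alpha.[j <- v i]%fmap psi
  end.

Definition satisfies alpha (phi : formula L) : Prop :=
  {subset free_vars phi <= domf alpha} /\ holds alpha phi.

End Semantics.

(* The interpretations of a family share their structure, so a family is that
   structure with a set of assignments.  The structure and the domain are kept
   as fields so that they are also determined for the empty family. *)
Record interp_family (L : vocabulary) := Family {
  str : structure L;
  dom : {fset nat};
  members : set (assignment str);
  members_dom : forall alpha, members alpha -> domf alpha = dom }.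
Arguments members {L}.

Section Families.
Variable L : vocabulary.
Implicit Types A B : interp_family L.

Definition separates A B (phi : formula L) : Prop :=
  (forall alpha, members A alpha -> satisfies alpha phi) /\
  (forall beta, members B beta -> satisfies beta (Neg phi)).

Definition choice_fun A := members A -> univ (str A).

Record kchoice_fun (k : nat) A := KChoice {
  kchoice : 'I_k -> choice_fun A;
  kchoice_inj : forall I : members A, injective (fun i => kchoice i I) }.

Definition selected A (k : nat) (F : choice_fun A) (Fk : kchoice_fun k A) : Prop :=
  forall I : members A, exists i : 'I_k, F I = kchoice Fk i I.

Definition extend_set A (j : nat) (F : choice_fun A) : set (assignment (str A)) :=
  [set (val I).[j <- F I]%fmap | I in [set: members A]].

Lemma bigcup_extend_dom A (j : nat) (T : Type) (F : T -> choice_fun A) alpha :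
  (\bigcup_(t in [set: T]) extend_set j (F t)) alpha ->
  domf alpha = (j |` dom A)%fset.
Proof.
by case=> t _ [I _ <-]; rewrite dom_setf (members_dom (set_mem (valP I))).
Qed.

(* The union over t of the families A(F_t / j). *)
Definition extend A (j : nat) (T : Type) (F : T -> choice_fun A) : interp_family L :=
  Family (@bigcup_extend_dom A j T F).

Lemma subfamily_dom A (C : set (assignment (str A))) alpha :
  (members A `&` C) alpha -> domf alpha = dom A.
Proof. by case=> /members_dom. Qed.

(* Intersecting with the members of A changes nothing when C is a block of a
   partition of A. *)
Definition subfamily A (C : set (assignment (str A))) : interp_family L :=
  Family (@subfamily_dom A C).

(* The blocks may be empty. *)
Definition partition2 A (C D : set (assignment (str A))) : Prop :=
  C `|` D = members A /\ C `&` D = set0.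

End Families.

Record position (L : vocabulary) := Position {
  weight : nat;
  lfam : interp_family L;
  rfam : interp_family L }.

Section Game.
Variables (L : vocabulary) (m : nat).
Implicit Types p q : position L.

(* The atomic formulas are those over x_1, ..., x_m: with arbitrary variables,
   a position whose domain contains an index j > m could be won by an atomic
   formula outside C_m. *)
Definition spoiler_wins_at p : Prop :=
  exists2 a : atomic L, in_C m (Atom a) & separates (lfam p) (rfam p) (Atom a).

Definition ended p : Prop := spoiler_wins_at p \/ weight p = 1.

Inductive move p : Type :=
| NegMove
| OrMove (u v : nat) (C D : set (assignment (str (lfam p))))
    of 0 < u & 0 < v & u + v = weight p & partition2 C D
| AndMove (u v : nat) (C D : set (assignment (str (rfam p))))
    of 0 < u & 0 < v & u + v = weight p & partition2 C D
| ExMove (j k : nat)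
    (F : kchoice_fun k (lfam p))
    (sel : kchoice_fun k (rfam p) -> choice_fun (rfam p))
    of var_index m j & 0 < k & forall G, selected (sel G) G
| AllMove (j k : nat)
    (F : kchoice_fun k (rfam p))
    (sel : kchoice_fun k (lfam p) -> choice_fun (lfam p))
    of var_index m j & 0 < k & forall G, selected (sel G) G.

(* The positions from which the game may continue after a move of Spoiler;
   Duplicator picks one of them. *)
Definition continuations p (mv : move p) : set (position L) :=
  let w := weight p in let A := lfam p in let B := rfam p in
  match mv with
  | NegMove => [set Position (w - 1) B A]
  | OrMove u v C D _ _ _ _ =>
      [set Position u (subfamily C) B; Position v (subfamily D) B]
  | AndMove u v C D _ _ _ _ =>
      [set Position u A (subfamily C); Position v A (subfamily D)]
  | ExMove j k F sel _ _ _ =>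
      [set Position (w - 1) (extend j (kchoice F)) (extend j sel)]
  | AllMove j k F sel _ _ _ =>
      [set Position (w - 1) (extend j sel) (extend j (kchoice F))]
  end.

(* A strategy of Spoiler may depend on the sequence of earlier positions. *)
Definition strategy := seq (position L) -> forall p, move p.

(* play sigma p0 h p: some play from p0 in which Spoiler follows sigma has
   reached p after going through the positions h. *)
Inductive play (sigma : strategy) (p0 : position L) :
    seq (position L) -> position L -> Prop :=
| play_start : play sigma p0 [::] p0
| play_step h p q : play sigma p0 h p -> ~ ended p ->
    continuations (sigma h p) q -> play sigma p0 (rcons h p) q.

(* There are no infinite plays from a position of positive weight: every move
   decreases the weight, which remains positive, and the game ends at weight 1
   at the latest. *)
Definition winning_strategy (sigma : strategy) (p0 : position L) : Prop :=
  forall h p, play sigma p0 h p -> ended p -> spoiler_wins_at p.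

Definition spoiler_has_winning_strategy (w : nat) (A B : interp_family L) : Prop :=
  exists sigma : strategy, winning_strategy sigma (Position w A B).

End Game.

(* Main.v *)
(* A formula separating A from B is a strategy for Spoiler, who plays the main
   connective and picks witnesses from its semantics; conversely a winning
   strategy is read off as a formula, by induction on the weight.

   The only delicate point is that a subformula may be obtained at a position
   both of whose families are empty, where nothing forces its free variables to
   lie in the common domain.  For a disjunction or conjunction one then keeps
   the other subformula alone.  For a quantifier with threshold k, this happens
   only if both families were already empty (and everything separates them), or
   one is empty and the universe of the other has fewer than k elements; the
   quantifier then separates them in front of any formula with no other free
   variable than the quantified one. *)
Require Import Defs.
From mathcomp Require Import all_boot finmap.
From mathcomp Require Import boolp classical_sets.

Set Implicit Arguments.
Unset Strict Implicit.
Unset Printing Implicit Defensive.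

Local Open Scope classical_set_scope.

(** * Separating formulas, one connective or quantifier at a time *)

Section Separation.
Variable L : vocabulary.
Implicit Types (A B : interp_family L) (phi psi chi : formula L).

Lemma separates_neg A B phi : separates A B (Neg phi) <-> separates B A phi.
Proof.
split=> -[sA sB]; split=> // a /[dup] Ha; [move/sB|move/sA] => -[sub h].
  by split=> //; apply: contrapT.
by split=> //= nh; apply: nh.
Qed.

(** De Morgan's law: with the two families exchanged, conjunction moves reduce to disjunction
    moves. *)
Lemma separates_and A B phi psi :
  separates A B (And phi psi) <-> separates B A (Or (Neg phi) (Neg psi)).
Proof.
split=> -[sA sB]; split=> a /[dup] Ha.
- by move/sB=> [sub h]; split=> //; apply/not_andP.
- by move/sA=> [sub [h1 h2]]; split=> // -[].
- by move/sB=> [sub] /not_orP[/contrapT ? /contrapT ?].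
- by move/sA=> [sub h]; split=> //=; apply/not_andP.
Qed.

Lemma separates_all A B k (k0 : 0 < k) j phi :
  separates A B (AllGeq k0 j phi) <-> separates B A (ExGeq k0 j (Neg phi)).
Proof.
split=> -[sA sB]; split=> // a /[dup] Ha; [move/sB|move/sA] => -[sub h].
  by split=> //; apply: contrapT.
by split=> //= nh; apply: nh.
Qed.

Lemma separates_or_partition A B phi psi :
  separates A B (Or phi psi) ->
  exists C D : set (assignment (str A)),
    [/\ partition2 C D, separates (subfamily C) B phi
      & separates (subfamily D) B psi].
Proof.
move=> [sA sB].
have sub1 S (a : assignment S) :
    {subset free_vars (Or phi psi) <= domf a} ->
    {subset free_vars phi <= domf a} /\ {subset free_vars psi <= domf a}.
  by move=> s; split=> x xf; apply: s; rewrite /= mem_cat xf ?orbT.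
(* The truth value of [phi] splits [A]; where [phi] fails, [psi] must hold. *)
exists (members A `&` [set a | holds a phi]).
exists (members A `\` [set a | holds a phi]); split.
- split; first by rewrite setUIDK.
  by apply/seteqP; split=> x // [[_ h] [_ nh]].
- split=> [a [Aa [_ /= h]]|b /sB[/sub1[s _] /not_orP[h _]] //].
  by have [/sub1[s _] _] := sA _ Aa.
- split=> [a [Aa [_ /= h]]|b /sB[/sub1[_ s] /not_orP[_ h]] //].
  by have [/sub1[_ s] []] := sA _ Aa.
Qed.

(** A member of [B], or one in each block, certifies that the free variables of both formulas lie in
    the common domain; the disjunction then separates. *)
Lemma partition_separates_or A B (C D : set (assignment (str A))) phi psi :
  dom A = dom B -> partition2 C D ->
  separates (subfamily C) B phi -> separates (subfamily D) B psi ->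
  [\/ separates A B phi, separates A B psi | separates A B (Or phi psi)].
Proof.
move=> eqAB [CD _] [sC phiB] [sD psiB].
have inA a : members A a -> members (subfamily C) a \/ members (subfamily D) a.
  by rewrite -CD => -[Ca|Da]; [left|right]; split=> //; rewrite -CD; [left|right].
have domC a : members (subfamily C) a -> {subset free_vars phi <= dom A}.
  by move=> Ca; rewrite -(members_dom Ca); case: (sC _ Ca).
have domD a : members (subfamily D) a -> {subset free_vars psi <= dom A}.
  by move=> Da; rewrite -(members_dom Da); case: (sD _ Da).
have domB b : members B b ->
    {subset free_vars phi <= dom A} /\ {subset free_vars psi <= dom A}.
  move=> Bb; rewrite eqAB -(members_dom Bb).
  by split; [case: (phiB _ Bb)|case: (psiB _ Bb)].
have or_case : {subset free_vars phi <= dom A} ->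
    {subset free_vars psi <= dom A} -> separates A B (Or phi psi).
  move=> s1 s2.
  have s : {subset free_vars (Or phi psi) <= dom A}.
    by move=> x; rewrite /= mem_cat => /orP[/s1|/s2].
  split=> [a Aa|b Bb]; split.
  - by rewrite (members_dom Aa).
  - by case: (inA _ Aa) => [/sC|/sD] [_ h]; [left|right].
  - by rewrite (members_dom Bb) -eqAB.
  - by move=> [h|h]; [case: (phiB _ Bb)|case: (psiB _ Bb)].
have [[b /domB[s1 s2]]|B0] := pselect (exists b, members B b).
  by apply: Or33; exact: or_case.
have [[c /domC s1]|C0] := pselect (exists c, members (subfamily C) c).
  have [[d /domD s2]|D0] := pselect (exists d, members (subfamily D) d).
    by apply: Or33; exact: or_case.
  (* Here [B] and the block of [psi] are empty, so [phi] alone covers [A]. *)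
  apply: Or31; split=> [a /inA[/sC //|Da]|b Bb]; last by case: B0; exists b.
  by case: D0; exists a.
apply: Or32; split=> [a /inA[Ca|/sD //]|b Bb]; last by case: B0; exists b.
by case: C0; exists a.
Qed.

Lemma members_extendP A j T (F : T -> choice_fun A) alpha :
  members (extend j F) alpha <->
  exists t (I : members A), alpha = (val I).[j <- F t I]%fmap.
Proof.
by split=> [[t _ [I _ <-]]|[t [I ->]]]; [exists t, I|exists t => //; exists I].
Qed.

(** On [A] Spoiler plays witnesses of the quantifier; on [B] any [k] distinct values include one
    where [phi] fails, and that one is selected. *)
Lemma separates_ex_kchoice A B k (k0 : 0 < k) j phi :
  separates A B (ExGeq k0 j phi) ->
  exists (F : kchoice_fun k A) (sel : kchoice_fun k B -> choice_fun B),
    (forall G, selected (sel G) G) /\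
    separates (extend j (kchoice F)) (extend j sel) phi.
Proof.
move=> [sA sB].
have sub S (a : assignment S) u :
    {subset free_vars (ExGeq k0 j phi) <= domf a} ->
    {subset free_vars phi <= domf a.[j <- u]%fmap}.
  move=> s x xf; rewrite dom_setf !inE; have [//|xj] := eqVneq x j.
  by apply: s; rewrite /= mem_filter xj.
have memb (E : interp_family L) (I : members E) : members E (val I).
  exact: (set_mem (valP I)).
have /choice[v vP] (I : members A) : exists v : 'I_k -> univ (str A),
    injective v /\ forall i, holds (val I).[j <- v i]%fmap phi.
  by have [_ [v]] := sA _ (memb _ I); exists v.
pose F := @KChoice _ k A (fun i I => v I i) (fun I => (vP I).1).
have /choice[c cP] (G : kchoice_fun k B) : exists c : members B -> 'I_k,
    forall I, ~ holds (val I).[j <- kchoice G (c I) I]%fmap phi.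
  suff /choice[c cP] I :
      exists i, ~ holds (val I).[j <- kchoice G i I]%fmap phi by exists c.
  have [_ nh] := sB _ (memb _ I).
  apply: contrapT => /forallNP h; apply: nh.
  exists (kchoice G ^~ I); first exact: kchoice_inj.
  by move=> i; apply: contrapT; apply: h.
exists F, (fun G I => kchoice G (c G I) I); split; first by move=> G I; exists (c G I).
split=> a /members_extendP[t [I ->]].
  by have [s _] := sA _ (memb _ I); split; [exact: sub|exact: (vP I).2].
have [s _] := sB _ (memb _ I).
by split; [exact: sub|exact: cP].
Qed.

(** Constant [k]-choice functions on [B] suffice: if [k] distinct values satisfied [phi] at some
    [b], the selection would pick one of them, where [phi] has to fail. *)
Lemma kchoice_separates_ex A B k (k0 : 0 < k) j
    (F : kchoice_fun k A) (sel : kchoice_fun k B -> choice_fun B) phi :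
  dom A = dom B -> (forall G, selected (sel G) G) ->
  separates (extend j (kchoice F)) (extend j sel) phi ->
  separates A B (ExGeq k0 j phi) \/
  forall chi, {subset free_vars chi <= [:: j]} ->
    separates A B (ExGeq k0 j chi).
Proof.
move=> eqAB selP [sF sG].
have constG b (Bb : members B b) (v : 'I_k -> univ (str B)) : injective v ->
    exists i, members (extend j sel) b.[j <- v i]%fmap.
  move=> v_inj.
  pose G := @KChoice _ k B (fun i _ => v i) (fun _ => v_inj).
  have [i e] := selP G (SigSub (mem_set Bb)).
  exists i; apply/members_extendP; exists G, (SigSub (mem_set Bb)).
  by rewrite e.
have extF a (Aa : members A a) i :
    members (extend j (kchoice F))
      a.[j <- kchoice F i (SigSub (mem_set Aa))]%fmap.
  by apply/members_extendP; exists i, (SigSub (mem_set Aa)).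
have [s|] := pselect {subset free_vars phi <= (j |` dom A)%fset}.
  left.
  have s' : {subset free_vars (ExGeq k0 j phi) <= dom A}.
    move=> x; rewrite /= mem_filter => /andP[xj /s].
    by rewrite !inE (negPf xj).
  split=> [a Aa|b Bb]; split.
  - by rewrite (members_dom Aa).
  - exists (fun i => kchoice F i (SigSub (mem_set Aa))).
      exact: kchoice_inj.
    by move=> i; have [] := sF _ (extF _ Aa i).
  - by rewrite (members_dom Bb) -eqAB.
  - by move=> [v /(constG _ Bb)[i /sG[_ /= nh]] h]; exact: nh (h i).
(* A free variable of [phi] outside the extended domain forces both extended families to be empty.
   As [k] is positive, [A] is empty, and if [B] has a member, its universe has no [k] distinct
   elements. *)
move=> ns; right=> chi chij.
have nF a : ~ members (extend j (kchoice F)) a.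
  by move=> Fa; apply: ns; case: (sF _ Fa); rewrite (members_dom Fa).
have nG b : ~ members (extend j sel) b.
  move=> Gb; apply: ns.
  by case: (sG _ Gb); rewrite (members_dom Gb) /= eqAB.
split=> [a Aa|b Bb]; first by have /nF := extF _ Aa (Ordinal k0).
split=> [x|[v /(constG _ Bb)[i /nG]] //].
by rewrite /= mem_filter => /andP[xj /chij]; rewrite inE (negPf xj).
Qed.

End Separation.

(** * Winning strategies against separating formulas *)

Section Strategies.
Variables (L : vocabulary) (m : nat).
Implicit Types (p q : position L) (sigma : @strategy L m).

Definition separable p : Prop := exists phi : formula L,
  [/\ in_C m phi, fsize phi <= weight p & separates (lfam p) (rfam p) phi].

Lemma fsize_gt0 (phi : formula L) : 0 < fsize phi.
Proof. by elim: phi => //= phi1 h1 phi2 h2; rewrite addn_gt0 h1. Qed.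

Lemma separable_move p : separable p -> ~ ended m p ->
  exists mv : move m p, forall q, continuations mv q -> separable q.
Proof.
case: p => w A B [phi [/=]].
case: phi => [a|phi|phi psi|phi psi|k k0 j phi|k k0 j phi] mC sz sep nend /=.
- by case: nend; left; exists a.
- exists (NegMove m _) => q /= ->; exists phi; split=> //=; last exact/separates_neg.
  by rewrite subn1 -ltnS prednK //; apply: leq_trans sz.
- have [C [D [CD sC sD]]] := separates_or_partition sep.
  move: mC; rewrite /in_C /= all_cat => /andP[m1 m2].
  (* The two weights must add up to exactly [w], so [psi] receives all that [phi] leaves over. *)
  have szv : fsize psi <= w - fsize phi by rewrite leq_subRL // (leq_trans _ sz) // leq_addr.
  have e : fsize phi + (w - fsize phi) = w.
    by rewrite subnKC // (leq_trans _ sz) // leq_addr.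
  exists (@OrMove _ m (Position w A B) _ _ C D (fsize_gt0 phi)
            (leq_trans (fsize_gt0 psi) szv) e CD).
  by move=> q /= [->|->]; [exists phi|exists psi].
- move/separates_and: sep => sep.
  have [C [D [CD sC sD]]] := separates_or_partition sep.
  move: mC; rewrite /in_C /= all_cat => /andP[m1 m2].
  have szv : fsize psi <= w - fsize phi by rewrite leq_subRL // (leq_trans _ sz) // leq_addr.
  have e : fsize phi + (w - fsize phi) = w.
    by rewrite subnKC // (leq_trans _ sz) // leq_addr.
  exists (@AndMove _ m (Position w A B) _ _ C D (fsize_gt0 phi)
            (leq_trans (fsize_gt0 psi) szv) e CD).
  move=> q /= [->|->]; [exists phi|exists psi]; split=> //=; exact/separates_neg.
- have [F [sel [selP s]]] := separates_ex_kchoice sep.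
  move: mC; rewrite /in_C /= => /andP[mj m1].
  exists (@ExMove _ m (Position w A B) j k F sel mj k0 selP) => q /= ->.
  by exists phi; split=> //=; rewrite subn1 -ltnS prednK //; apply: leq_trans sz.
- move/separates_all: sep => sep.
  have [F [sel [selP /separates_neg s]]] := separates_ex_kchoice sep.
  move: mC; rewrite /in_C /= => /andP[mj m1].
  exists (@AllMove _ m (Position w A B) j k F sel mj k0 selP) => q /= ->.
  by exists phi; split=> //=; rewrite subn1 -ltnS prednK //; apply: leq_trans sz.
Qed.

(** Every non-atomic formula has size at least 2, so at weight 1 the separating formula is
    atomic. *)
Lemma separable_ended p : separable p -> ended m p -> spoiler_wins_at m p.
Proof.
move=> [phi [mC sz sep]] [//|w1]; rewrite w1 in sz.
case: phi mC sz sep => [a|phi|phi psi|phi psi|k k0 j phi|k k0 j phi] mC /= sz sep.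
- by exists a.
all: have := fsize_gt0 phi; try have := fsize_gt0 psi.
all: by move: sz; case: (fsize phi) => // -[|?] //; case: (fsize psi).
Qed.

(** Separability is an invariant of the plays that follow the moves of [separable_move]. *)
Lemma separable_winning w A B : separable (Position w A B) ->
  spoiler_has_winning_strategy m w A B.
Proof.
move=> sep0.
have mvP p : exists mv : move m p, separable p -> ~ ended m p ->
    forall q, continuations mv q -> separable q.
  have [[s e]|n] := pselect (separable p /\ ~ ended m p).
    by have [mv h] := separable_move s e; exists mv.
  (* A strategy is total: negation serves as the default move at ended or inseparable positions. *)
  by exists (NegMove m p) => s e; case: n.
exists (fun _ p => projT1 (cid (mvP p))) => h p pl.
suff : separable p by exact: separable_ended.
elim: pl => // {}h {}p q _ sp e; exact: (projT2 (cid (mvP p))).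
Qed.

(** The residual strategy puts [p] in front of the history, so its plays from [q] are tails of plays
    from [p]. *)
Lemma winning_strategy_step sigma p q : ~ ended m p ->
  winning_strategy sigma p -> continuations (sigma [::] p) q ->
  winning_strategy (fun h => sigma (p :: h)) q.
Proof.
move=> e win pq h r pl; apply: (win (p :: h)).
elim: pl => {h r} [|h r s _ IH nr rs].
  exact: (play_step (play_start _ _)).
rewrite -rcons_cons; exact: play_step IH nr rs.
Qed.

Lemma winning_separable sigma p : dom (lfam p) = dom (rfam p) ->
  0 < weight p -> winning_strategy sigma p -> separable p.
Proof.
(* Strong induction on the weight, since a split may lower it by more than one. *)
move: {2}(weight p) (leqnn (weight p)) => n.
elim: n sigma p => [|n IH] sigma p; first by case: (weight p).
case: p => w A B /= wn eqAB w0 win.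
have [e|ne] := pselect (ended m (Position w A B)).
  have [a mC sep] := win _ _ (play_start _ _) e.
  by exists (Atom a).
have w1 : 1 < w.
  by case: w w0 ne {wn win} => [|[|w]] // _ []; right.
have w1n : w - 1 <= n by rewrite leq_subLR.
have w10 : 0 < w - 1 by rewrite subn_gt0.
have w1S : (w - 1).+1 = w by rewrite subn1 prednK.
have step q : continuations (sigma [::] (Position w A B)) q ->
    weight q <= n -> dom (lfam q) = dom (rfam q) -> 0 < weight q -> separable q.
  by move=> /(winning_strategy_step ne win) wq qn eq q0; apply: IH wq.
case: (sigma [::] _) step => /=.
- move=> /(_ _ erefl)[//|//|//|/= phi [mC sz /separates_neg sep]].
  by exists (Neg phi); split=> //=; rewrite -w1S ltnS.
- move=> u v C D u0 v0 uv CD step.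
  have un : u <= n by rewrite -ltnS; apply: leq_trans wn; rewrite -uv -addn1 leq_add2l.
  have vn : v <= n by rewrite -ltnS; apply: leq_trans wn; rewrite -uv -add1n leq_add2r.
  have [//|//|//|phi [/= m1 sz1 s1]] := step _ (or_introl erefl).
  have [//|//|//|psi [/= m2 sz2 s2]] := step _ (or_intror erefl).
  have uw : u <= w by rewrite -uv leq_addr.
  have vw : v <= w by rewrite -uv leq_addl.
  have [s|s|s] := partition_separates_or eqAB CD s1 s2.
  + by exists phi; split=> //; apply: leq_trans uw.
  + by exists psi; split=> //; apply: leq_trans vw.
  + by exists (Or phi psi); split=> //=; rewrite ?/in_C /= ?all_cat -?uv ?leq_add //; apply/andP.
- move=> u v C D u0 v0 uv CD step.
  have un : u <= n by rewrite -ltnS; apply: leq_trans wn; rewrite -uv -addn1 leq_add2l.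
  have vn : v <= n by rewrite -ltnS; apply: leq_trans wn; rewrite -uv -add1n leq_add2r.
  have [//|//|//|phi [/= m1 sz1 /separates_neg s1]] := step _ (or_introl erefl).
  have [//|//|//|psi [/= m2 sz2 /separates_neg s2]] := step _ (or_intror erefl).
  have uw : u <= w by rewrite -uv leq_addr.
  have vw : v <= w by rewrite -uv leq_addl.
  (* Applied to the negated formulas with the families exchanged; the negations cancel afterwards
     and cost no size. *)
  have [s|s|s] := partition_separates_or (esym eqAB) CD s1 s2.
  + by exists phi; split=> //=; [exact: leq_trans uw|exact/separates_neg].
  + by exists psi; split=> //=; [exact: leq_trans vw|exact/separates_neg].
  + exists (And phi psi); split=> /=; last exact/separates_and.
      by rewrite /in_C /= all_cat; apply/andP.
    by rewrite -uv leq_add.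
- move=> j k F sel mj k0 selP step.
  have [//|/=|//|phi [/= m1 sz1 s1]] := step _ erefl; first by rewrite eqAB.
  have [s|s] := kchoice_separates_ex k0 eqAB selP s1.
    by exists (ExGeq k0 j phi); split=> //=; [exact/andP|rewrite -w1S ltnS].
  (* Any body with [j] as its only free variable works here; this one gives size 2, which fits
     because [1 < w]. *)
  exists (ExGeq k0 j (Atom (Eq (Var j) (Var j)))).
  by split=> //=; [rewrite /in_C /= mj|apply: s => x; rewrite !inE orbb].
- move=> j k F sel mj k0 selP step.
  have [//|/=|//|phi [/= m1 sz1 /separates_neg s1]] := step _ erefl.
    by rewrite eqAB.
  have [s|s] := kchoice_separates_ex k0 (esym eqAB) selP s1.
    exists (AllGeq k0 j phi).
    by split=> /=; [exact/andP|rewrite -w1S ltnS|exact/separates_all].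
  exists (AllGeq k0 j (Atom (Eq (Var j) (Var j)))).
  split=> //=; first by rewrite /in_C /= mj.
  by apply/separates_all/s => x; rewrite !inE orbb.
Qed.

End Strategies.

Theorem theorem3 (L : vocabulary) (m : nat) (A B : interp_family L) (w : nat) :
  1 <= m ->
  dom A = dom B ->
  #|` dom A|%fset <= m ->
  0 < w ->
  (spoiler_has_winning_strategy m w A B <->
   exists phi : formula L, [/\ in_C m phi, fsize phi <= w & separates A B phi]).
Proof.
move=> _ eqAB _ w0; split; last exact: separable_winning.
by move=> [sigma win]; apply: winning_separable win.
Qed.
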